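(* (Generalized Fano's inequality.) Let $\Theta$ be a parameter space, $\mathcal{A}$ an action space, $\mathcal{P}=\{P_\theta:\theta\in\Theta\}$ a family of probability measures on a sample space $\mathcal{X}$, $w$ any prior probability measure on $\Theta$, and $L:\Theta\times\mathcal{A}\to\{0,1\}$ any zero-one valued loss. Let $B(a):=\{\theta\in\Theta:L(\theta,a)=0\}$ for $a\in\mathcal{A}$ and $R_0:=\inf_{a\in\mathcal{A}}\int_\Theta L(\theta,a)\,w(\mathrm{d}\theta)=1-\sup_{a\in\mathcal{A}}w(B(a))$, with $R_0>0$. Then $$R_{\rm Bayes}(w,L;\Theta)\;\ge\;1+\frac{I(w,\mathcal{P})+\log(1+R_0)}{\log\big(\sup_{a\in\mathcal{A}}w(B(a))\big)}.$$
   Context: All functions and sets are assumed measurable as needed. The Bayes risk is $R_{\rm Bayes}(w,L;\Theta):=\inf_{\mathfrak{d}}\int_\Theta \mathbb{E}_\theta L(\theta,\mathfrak{d}(X))\,w(\mathrm{d}\theta)$, the infimum being over all decision rules $\mathfrak{d}:\mathcal{X}\to\mathcal{A}$, where $\mathbb{E}_\theta$ is expectation under $X\sim P_\theta$. $I(w,\mathcal{P}):=\inf_Q\int_\Theta D(P_\theta\|Q)\,w(\mathrm{d}\theta)$, the infimum being over all probability measures $Q$ on $\mathcal{X}$, where $D(P\|Q)$ is the Kullback–Leibler divergence ($+\infty$ if $P$ is not absolutely continuous with respect to $Q$); this is the mutual information between $\theta\sim w$ and $X\mid\theta\sim P_\theta$. Logarithms are natural. Conventions: if $\sup_a w(B(a))=0$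 its logarithm is $-\infty$ and a finite number divided by $-\infty$ is $0$; if $I(w,\mathcal{P})=\infty$ the right-hand side is read as $-\infty$ (the bound is vacuous). *)

(* Defs.v *)
From HB Require Import structures.
From mathcomp Require Import all_boot all_order all_algebra.
From mathcomp Require Import all_classical all_reals all_analysis.
From mathcomp Require Import measurable_realfun.

Set Implicit Arguments.
Unset Strict Implicit.
Unset Printing Implicit Defensive.
Import Order.TTheory GRing.Theory Num.Theory.
Import numFieldNormedType.Exports.

Local Open Scope classical_set_scope.
Local Open Scope ring_scope.
Local Open Scope ereal_scope.
Local Open Scope charge_scope.

(* The value of [lne (dP/dQ)] is irrelevant where the derivative is
   nonpositive, since that set is P-null. *)
Definition kl_div {d} {T : measurableType d} {R : realType}
    (P Q : probability T R) : \bar R :=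
  if `[< P `<< Q >]
  then \int[P]_x lne (('d (charge_of_finite_measure P) '/d Q) x)
  else +oo.

(* If [t |-> kl_div (P t) Q] is not measurable, the integral below is the
   lower integral of this nonnegative function. *)
Definition mutual_info {dT dX} {Theta : measurableType dT}
    {X : measurableType dX} {R : realType}
    (w : probability Theta R) (P : Theta -> probability X R) : \bar R :=
  ereal_inf (range (fun Q : probability X R => \int[w]_t kl_div (P t) Q)).

Definition bayes_risk {dT dX dA} {Theta : measurableType dT}
    {X : measurableType dX} {A : measurableType dA} {R : realType}
    (w : probability Theta R) (P : Theta -> probability X R)
    (L : Theta -> A -> R) : \bar R :=
  ereal_inf [set \int[w]_t \int[P t]_x (L t (dec x))%:E
            | dec in [set dec : X -> A | measurable_fun [set: X] dec]].

Definition zero_loss_set {Theta A : Type} {R : realType}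
    (L : Theta -> A -> R) (a : A) : set Theta := [set t | L t a = 0%R].

Definition sup_zero_loss {dT} {Theta : measurableType dT} {A : Type}
    {R : realType} (w : probability Theta R) (L : Theta -> A -> R) : \bar R :=
  ereal_sup (range (fun a => w (zero_loss_set L a))).

Definition no_data_risk {dT} {Theta : measurableType dT} {A : Type}
    {R : realType} (w : probability Theta R) (L : Theta -> A -> R) : \bar R :=
  ereal_inf (range (fun a => \int[w]_t (L t a)%:E)).

(* In the library [-oo^-1 = -oo]; here a finite number divided by -oo is 0. *)
Definition ediv_Ny {R : realType} (x y : \bar R) : \bar R :=
  if (x \is a fin_num) && (y == -oo) then 0 else x / y.

(* [lne x = -oo] for [x <= 0], in particular for [s = 0]. *)
Definition fano_bound {R : realType} (I R0 s : \bar R) : \bar R :=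
  if I == +oo then -oo else 1 + ediv_Ny (I + lne (1 + R0)) (lne s).

Lemma no_data_riskE {dT dA} {Theta : measurableType dT}
    {A : measurableType dA} {R : realType} (w : probability Theta R)
    (L : Theta -> A -> R) :
  (forall t a, L t a = 0%R \/ L t a = 1%R) ->
  measurable_fun [set: Theta * A] (fun p => L p.1 p.2) ->
  no_data_risk w L = 1 - sup_zero_loss w L.
Proof.
move=> L01 mL.
have mLa a : measurable_fun [set: Theta] (L ^~ a).
  exact: (measurableT_comp mL (pair2_measurable a)).
have mB a : measurable (zero_loss_set L a).
  rewrite (_ : zero_loss_set L a = [set: Theta] `&` (L ^~ a) @^-1` [set 0%R]).
    exact: mLa.
  by rewrite setTI.
have E a : \int[w]_t (L t a)%:E = 1 - w (zero_loss_set L a).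
  rewrite -probability_setC// -[RHS]mul1e -integral_cst; last exact: measurableC.
  rewrite [RHS]integral_mkcond; apply: eq_integral => t _.
  rewrite patchE; case: ifPn => [|].
    by rewrite inE /zero_loss_set/=; case: (L01 t a) => ->.
  by rewrite notin_setE /zero_loss_set/= => /contrapT ->.
rewrite /no_data_risk /sup_zero_loss; under eq_fun do rewrite E.
have -> : range (fun a => 1 - w (zero_loss_set L a)) =
  [set 1 - x | x in range (fun a => w (zero_loss_set L a))].
  by rewrite image_comp.
set S := (X in ereal_sup X); rewrite -/S.
have S01 x : S x -> 0 <= x <= 1.
  by move=> [a _ <-]; rewrite measure_ge0 probability_le1.
have fin_S x : S x -> x \is a fin_num.
  by move=> /S01/andP[x0 x1]; rewrite ge0_fin_numE// (le_lt_trans x1)// ltry.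
apply/eqP; rewrite eq_le; apply/andP; split; last first.
  apply: le_ereal_inf_tmp => _ [x Sx <-].
  by rewrite leeB// ereal_sup_ubound.
have [S0|/set0P[x0 Sx0]] := eqVneq S set0.
  by rewrite S0 image_set0 ereal_sup0 ereal_inf0.
have fS : ereal_sup S \is a fin_num.
  rewrite fin_numE -ltNye -ltey; apply/andP; split.
    have /andP[x00 _] := S01 _ Sx0.
    by rewrite (lt_le_trans _ (ereal_sup_ubound Sx0))// (lt_le_trans _ x00)// ltNyr.
  rewrite (@le_lt_trans _ _ 1) ?ltry//; apply: ge_ereal_sup => x /S01/andP[]//.
set t := ereal_inf _.
have ubt x : S x -> t <= 1 - x by move=> Sx; apply: ereal_inf_lbound; exists x.
have ft : t \is a fin_num.
  have t0 : 0 <= t.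
    apply: le_ereal_inf_tmp => _ [x Sx <-]; have /andP[_ x1] := S01 _ Sx.
    by rewrite suber_ge0 ?fin_S.
  rewrite ge0_fin_numE// (le_lt_trans (ubt _ Sx0))//.
  by move: (fin_S _ Sx0); case: (x0) => [r||] // _; rewrite ltry.
rewrite leeBrDr// addeC -leeBrDr//; apply: ge_ereal_sup => x Sx.
by rewrite leeBrDr// addeC -leeBrDr ?fin_S// ubt.
Qed.

(* Main.v *)
From HB Require Import structures.
Require Import Defs.
From mathcomp Require Import all_boot all_order all_algebra.
From mathcomp Require Import all_classical all_reals all_analysis.
From mathcomp Require Import measurable_realfun ring lra.

(** The bound is a change of measure tested on the event that the decision is
    right.  Fix a decision rule dec and a probability Q on the sample space,
    and put B_t = {x | L t (dec x) = 0}, so that the risk of dec is 1 - p with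
    p the w-average of P_t(B_t).  Relative entropy dominates its variational
    lower bounds: for every test function h,

      int h dP + 1 - int exp h dQ <= D(P || Q)     ([kl_div_ge_variational]),

    which is log y <= y - 1 applied to y = exp h / (dP/dQ).  The test function
    h = l 1_{B_t} - log c with l >= 0 and c > 0 gives a lower bound of
    D(P_t || Q) that is affine in P_t(B_t) and Q(B_t) ([kl_div_ge_event]), so
    averaging over w only involves p and the w-average q of Q(B_t).  Under Q
    the observation carries no information on t: by Tonelli, q is a Q-average
    of the numbers w(B(dec x)), hence at most s, the supremum of the w(B(a))
    ([Rintegral_xsection_le]).  The choice c = 1 + (exp l - 1) s then gives

      l p - log (1 + (exp l - 1) s) <= int D(P_t || Q) w(dt)

    for all l >= 0 ([integral_kl_div_ge]), and the infimum over Q replaces the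
    right-hand side by the mutual information I.

    If 0 < s, the choice l = - log s makes exp l * s = 1, the logarithm becomes
    log (2 - s) = log (1 + R0), and solving for 1 - p gives the claim.  If
    s = 0, the inequality reads l p <= I for all l, so a finite I forces p <= 0
    and the risk is at least 1 ([fano_bound_le]).

    The family t |-> D(P_t || Q) need not be measurable, and its integral is
    then a lower integral.  This is harmless because the lower bounds used
    above are measurable in t and the integral is monotone on arbitrary
    functions ([integral_le]). *)

Import Order.TTheory GRing.Theory Num.Theory.

Local Open Scope classical_set_scope.
Local Open Scope ring_scope.
Local Open Scope ereal_scope.

(** * Integration preliminaries *)

(** The integral of a nonnegative function is a supremum over the simple
    functions below it, so monotonicity needs neither measurability nor
    integrability; a difference oo - oo, being -oo, is no obstacle either. *)
Lemma integral_le {d} {T : measurableType d} {R : realType}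
    (mu : {measure set T -> \bar R}) (u v : T -> \bar R) :
  (forall x, u x <= v x) -> \int[mu]_x u x <= \int[mu]_x v x.
Proof.
have ge0_le f g : (forall x, 0 <= f x) -> (forall x, f x <= g x) ->
    \int[mu]_x f x <= \int[mu]_x g x.
  move=> f0 fg; have g0 x : 0 <= g x by exact: le_trans (f0 x) (fg x).
  rewrite !ge0_integralTE//; apply: le_ereal_sup => _ [h hf <-].
  by exists h => // x; exact: le_trans (hf x) (fg x).
move=> uv; rewrite integralE [leRHS]integralE leeB//; apply: ge0_le => x //.
  by apply: (@funepos_le _ _ [set: T] u v) => //; rewrite in_setT.
by apply: (@funeneg_le _ _ [set: T] u v) => //; rewrite in_setT.
Qed.

Lemma integral_prob_cst {d} {T : measurableType d} {R : realType}
    (mu : probability T R) (c : R) : \int[mu]_x c%:E = c%:E.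
Proof.
transitivity (c%:E * mu [set: T]); first exact: integral_cst.
by rewrite probability_setT mule1.
Qed.

Lemma integral_affine {d} {T : measurableType d} {R : realType}
    (mu : probability T R) (u : T -> R) (a c : R) :
  mu.-integrable [set: T] (EFin \o u) ->
  mu.-integrable [set: T] (fun x => (a * u x + c)%:E) /\
  \int[mu]_x (a * u x + c)%:E = (a * (\int[mu]_x u x)%R + c)%:E.
Proof.
move=> iu; have iau := integrableZl measurableT a iu.
have ic : mu.-integrable [set: T] (EFin \o cst c).
  exact: finite_measure_integrable_cst.
have E : (fun x => (a * u x + c)%:E) =
    (fun x => a%:E * (u x)%:E) \+ (EFin \o cst c).
  by apply/funext => x; rewrite EFinD EFinM.
split; first by rewrite E; exact: integrableD.
rewrite E integralD// integralZl// (integral_prob_cst mu c).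
by rewrite EFinD EFinM fineK// integrable_fin_num.
Qed.

Lemma Rintegral_indic {d} {T : measurableType d} {R : realType}
    (mu : probability T R) (B : set T) : measurable B ->
  (\int[mu]_x (\1_B x : R))%R = fine (mu B).
Proof. by move=> mB; rewrite /Rintegral integral_indic// setIT. Qed.

Lemma integrable_fine_prob {d} {T : measurableType d} {R : realType}
    (mu : probability T R) (m : T -> \bar R) :
  measurable_fun [set: T] m -> (forall t, 0 <= m t <= 1) ->
  mu.-integrable [set: T] (EFin \o (fine \o m)).
Proof.
move=> mm m01; apply: measurable_bounded_integrable => //.
- by rewrite (@le_lt_trans _ _ 1) ?ltry// probability_le1.
- exact: measurableT_comp (fine_measurable measurableT) mm.
exists 1%R; split; first exact: num_real.
move=> M M1 t _ /=; have /andP[m0 m1] := m01 t.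
rewrite ger0_norm ?fine_ge0// (le_trans _ (ltW M1))// -lee_fin fineK//.
by rewrite ge0_fin_numE// (le_lt_trans m1)// ltry.
Qed.

(** * Variational lower bounds of relative entropy *)

(** Writing f = dP/dQ, log y <= y - 1 at y = exp h / f reads
    h + 1 - exp h / f <= log f where f > 0, that is P-almost everywhere, and
    the P-integral of exp h / f is at most the Q-integral of exp h.  The
    minorant is P-integrable, hence the inequality holds even if the integral
    of log f is infinite. *)
Lemma kl_div_ge_variational {d} {T : measurableType d} {R : realType}
    (P Q : probability T R) (h : T -> R) :
  P.-integrable [set: T] (EFin \o h) ->
  Q.-integrable [set: T] (fun x => (expR (h x))%:E) ->
  \int[P]_x (h x)%:E + 1 - \int[Q]_x (expR (h x))%:E <= kl_div P Q.
Proof.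
move=> ih ieh; rewrite /kl_div; case: ifPn => [/asboolP PQ|_]; last exact: leey.
set f0 := Radon_Nikodym _ _.
(* [f0] may be negative on a null set; [f] is an everywhere nonnegative
   version of the same density. *)
pose f := Radon_Nikodym_SigmaFinite.f P Q.
have f_ge0 x : 0 <= f x by exact: Radon_Nikodym_SigmaFinite.f_ge0.
have f_fin x : f x \is a fin_num by exact: Radon_Nikodym_SigmaFinite.f_fin_num.
have mf : measurable_fun [set: T] f.
  exact: measurable_int (Radon_Nikodym_SigmaFinite.f_integrable PQ).
have mf0 : measurable_fun [set: T] f0.
  by apply: measurable_int; apply: Radon_Nikodym_integrable; exact: PQ.
have mh : measurable_fun [set: T] h.
  by have /measurable_int/measurable_EFinP := ih.
(* [g] is [exp h / f], cut off to 0 where [f] vanishes. *)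
pose g x := if 0 < f x then (expR (h x - ln (fine (f x))))%:E else 0.
have g_ge0 x : 0 <= g x.
  by rewrite /g; case: ifPn => // _; rewrite lee_fin expR_ge0.
have mg : measurable_fun [set: T] g.
  apply: measurable_fun_ifT => //; first exact: measurable_fun_lte.
  apply/measurable_EFinP; apply: measurableT_comp => //.
  apply: measurable_funB => //; apply: measurableT_comp => //.
  exact: measurableT_comp (fine_measurable measurableT) mf.
have gP : \int[P]_x g x <= \int[Q]_x (expR (h x))%:E.
  rewrite -(Radon_Nikodym_SigmaFinite.change_of_variables PQ)//.
  apply: integral_le => x; rewrite -/f /g; case: ifPn => [fx0|_].
    have fx0' : (0 < fine (f x))%R by rewrite fine_gt0// fx0 ltey_eq f_fin.
    rewrite -[X in _ * X](fineK (f_fin x)) -EFinM expRD expRN lnK//.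
    by rewrite mulfVK ?gt_eqF.
  by rewrite mul0e lee_fin expR_ge0.
have ig : P.-integrable [set: T] g.
  apply/integrableP; split => //; under eq_integral do rewrite gee0_abs//.
  apply: (le_lt_trans gP); rewrite -ge0_fin_numE; first exact: integrable_fin_num.
  by apply: integral_ge0 => x _; rewrite lee_fin expR_ge0.
have i1 : P.-integrable [set: T] (EFin \o cst 1%R).
  exact: finite_measure_integrable_cst.
pose k x : \bar R := (h x)%:E + 1 - g x.
have kE : \int[P]_x k x = \int[P]_x (h x)%:E + 1 - \int[P]_x g x.
  rewrite integralB//; last exact: integrableD.
  by rewrite integralD// (integral_prob_cst P 1).
have mk : measurable_fun [set: T] k.
  apply: emeasurable_funB => //; apply: emeasurable_funD => //.
  exact/measurable_EFinP.
rewrite (@le_trans _ _ (\int[P]_x k x))//.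
  by rewrite kE leeB.
(* Lowering [k] to [-oo] off the set of full measure where [0 < f = f0] turns
   an almost everywhere inequality into an everywhere one. *)
pose k' x := if (0 < f x) && (f x == f0 x) then k x else -oo.
rewrite (@ae_eq_integral _ _ _ P _ k' k)//.
- apply: integral_le => x; rewrite /k'.
  case: ifPn => [/andP[fx0 /eqP <-]|_]; last exact: leNye.
  rewrite /k /g fx0.
  have fx0' : (0 < fine (f x))%R by rewrite fine_gt0// fx0 ltey_eq f_fin.
  rewrite -(fineK (f_fin x)) lne_EFin// -!EFinD lee_fin/=.
  by have := expR_ge1Dx (h x - ln (fine (f x))); lra.
- apply: measurable_fun_ifT => //; apply: measurable_and; first exact: measurable_fun_lte.
  exact: measurable_fun_eqe.
have ff0 : ae_eq P [set: T] f f0.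
  apply: (null_dominates_ae_eq measurableT PQ).
  exact: ae_eq_Radon_Nikodym_SigmaFinite.
have mN : measurable [set x | f x = 0].
  by rewrite -[X in measurable X]setTI; exact: measurable_eqe.
have f_gt0 : {ae P, forall x, 0 < f x}.
  exists [set x | f x = 0]; split.
  - exact: mN.
  - rewrite (Radon_Nikodym_SigmaFinite.f_integral PQ)//.
    by rewrite integral0_eq// => x.
  - by move=> x /= /negP; rewrite -leNgt => fx0; apply/eqP; rewrite eq_le fx0 f_ge0.
apply: filterS2 ff0 f_gt0 => x /= + fx0 _.
by rewrite /k' fx0 => /(_ I) <-; rewrite eqxx.
Qed.

(** Two-valued test functions: [h = l] on [B] and [0] elsewhere, shifted by
    [- ln c].  The optimal [c] depends on [Q B] through a logarithm; keeping it
    free makes the bound affine in [P B] and [Q B], so that it can be averaged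
    over a family of measures. *)
Lemma kl_div_ge_event {d} {T : measurableType d} {R : realType}
    (P Q : probability T R) (B : set T) (l c : R) :
  measurable B -> (0 < c)%R ->
  (l * fine (P B) + (1 - ln c) - ((expR l - 1) * fine (Q B) + 1) / c)%:E <=
  kl_div P Q.
Proof.
move=> mB c0; pose h x := (l * \1_B x + - ln c)%R.
have [ih Eh] := integral_affine P _ l (- ln c) (integrable_indic P mB).
have [ie Ee] := integral_affine Q _ ((expR l - 1) / c) c^-1 (integrable_indic Q mB).
have ehE x : (expR (h x) = (expR l - 1) / c * \1_B x + c^-1)%R.
  rewrite /h expRD expRN lnK//; rewrite indicE; case: (x \in B) => /=.
    by rewrite !mulr1 mulrBl mul1r subrK.
  by rewrite !mulr0 expR0 mul1r add0r.
apply: le_trans (kl_div_ge_variational P Q h _ _) => //; last first.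
  by under eq_fun do rewrite ehE.
under [X in _ - X]eq_integral do rewrite ehE.
rewrite Ee Eh !Rintegral_indic// -!EFinD lee_fin.
by rewrite mulrDl mul1r mulrAC; lra.
Qed.

(** * Averaging over the prior *)

Lemma measurable_fun_xsection_prob {dT dX} {Theta : measurableType dT}
    {X : measurableType dX} {R : realType} (P : Theta -> probability X R)
    (C : set (Theta * X)) :
  (forall B, measurable B -> measurable_fun [set: Theta] (fun t => P t B)) ->
  measurable C -> measurable_fun [set: Theta] (fun t => P t (xsection C t)).
Proof.
move=> mP mC.
pose k : Theta -> {measure set X -> \bar R} := P.
pose k1 := isKernel.Build _ _ _ _ R k mP.
pose K : R.-ker Theta ~> X := HB.pack k k1.
pose k2 := Kernel_isProbability.Build _ _ _ _ R K
  (fun t => probability_setT (P t)).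
pose K2 : R.-pker Theta ~> X := HB.pack (K : Theta -> _) k1 k2.
exact: (@measurable_fun_xsection_finite_kernel _ _ _ _ _ K2 C (mem_set mC)).
Qed.

(** By Tonelli, the [w]-average of the [Q]-measures of the vertical sections of
    [C] is the [Q]-average of the [w]-measures of its horizontal sections. *)
Lemma Rintegral_xsection_le {dT dX} {Theta : measurableType dT}
    {X : measurableType dX} {R : realType} (w : probability Theta R)
    (Q : probability X R) (C : set (Theta * X)) (s : R) :
  measurable C -> (forall x, w (ysection C x) <= s%:E) ->
  (\int[w]_t fine (Q (xsection C t)) <= s)%R.
Proof.
move=> mC ws.
have iQ : w.-integrable [set: Theta]
    (EFin \o (fine \o (fun t => Q (xsection C t)))).
  apply: integrable_fine_prob; first exact: measurable_fun_xsection.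
  by move=> t; rewrite measure_ge0 probability_le1//; exact: measurable_xsection.
rewrite -lee_fin /Rintegral fineK; last exact: integrable_fin_num iQ.
have -> : \int[w]_t (fine (Q (xsection C t)))%:E =
    \int[w]_t Q (xsection C t).
  apply: eq_integral => t _; rewrite fineK// fin_num_measure//.
  exact: measurable_xsection.
have := indic_fubini_tonelli w Q mC.
rewrite indic_fubini_tonelli_FE// indic_fubini_tonelli_GE// => ->.
by rewrite -(integral_prob_cst Q s); apply: integral_le => x; exact: ws.
Qed.

(** Here [C] is the set of pairs (parameter, observation) for which some guess
    is right.  Under the joint law of parameter and observation its mass may be
    large, but under the product of [w] and [Q] it is at most [s]; the
    divergence pays for the gap. *)
Lemma integral_kl_div_ge {dT dX} {Theta : measurableType dT}
    {X : measurableType dX} {R : realType} (w : probability Theta R)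
    (P : Theta -> probability X R) (Q : probability X R)
    (C : set (Theta * X)) (s l : R) :
  (forall B, measurable B -> measurable_fun [set: Theta] (fun t => P t B)) ->
  measurable C -> (forall x, w (ysection C x) <= s%:E) -> (0 <= s)%R ->
  (0 <= l)%R ->
  (l * (\int[w]_t fine (P t (xsection C t)))%R - ln (1 + (expR l - 1) * s))%:E
  <= \int[w]_t kl_div (P t) Q.
Proof.
move=> mP mC ws s0 l0; set c := (1 + _)%R.
have el1 : (0 <= expR l - 1)%R by rewrite subr_ge0 -expR0 ler_expR.
have c0 : (0 < c)%R by rewrite /c ltr_pwDl// mulr_ge0.
have mCt t : measurable (xsection C t) by exact: measurable_xsection.
have iP : w.-integrable [set: Theta]
    (EFin \o (fine \o (fun t => P t (xsection C t)))).
  apply: integrable_fine_prob; first exact: measurable_fun_xsection_prob.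
  by move=> t; rewrite measure_ge0 probability_le1.
have iQ : w.-integrable [set: Theta]
    (EFin \o (fine \o (fun t => Q (xsection C t)))).
  apply: integrable_fine_prob; first exact: measurable_fun_xsection.
  by move=> t; rewrite measure_ge0 probability_le1.
have [iP' EP] := integral_affine w _ l (1 - ln c) iP.
have [iQ' EQ] := integral_affine w _ (- (expR l - 1) / c) (- c^-1) iQ.
apply: le_trans; last first.
  by apply: integral_le => t; exact: (kl_div_ge_event (P t) Q _ l c (mCt t) c0).
under eq_integral => t _.
  rewrite (_ : _%:E = (l * fine (P t (xsection C t)) + (1 - ln c))%:E +
     (- (expR l - 1) / c * fine (Q (xsection C t)) - c^-1)%:E); last first.
    by rewrite -EFinD; congr EFin; rewrite mulrDl mul1r; ring.
  over.
rewrite integralD// EP EQ -EFinD lee_fin.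
have := Rintegral_xsection_le w Q C s mC ws.
set q := (\int[w]_t _)%R => qs; set p := (\int[w]_t _)%R.
(* Multiplied by [c], this compares [q] with [s] in the definition of [c]. *)
suff : ((expR l - 1) / c * q + c^-1 <= 1)%R.
  by rewrite !mulNr; lra.
rewrite mulrAC -[X in (_ + X)%R]mul1r -mulrDl ler_pdivrMr// mul1r /c addrC.
by rewrite lerD2l ler_wpM2l.
Qed.

(** * Choosing the tilt *)

(** Of the family of inequalities indexed by [l], the one at [l = - ln s] is the
    bound for [0 < s]; for [s = 0] the limit [l -> +oo] is needed. *)
Lemma fano_bound_le {R : realType} (I : \bar R) (s p : R) :
  (0 <= s < 1)%R ->
  (forall l, (0 <= l)%R -> (l * p - ln (1 + (expR l - 1) * s))%:E <= I) ->
  fano_bound I (1 - s%:E) s%:E <= (1 - p)%:E.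
Proof.
move=> /andP[s0 s1] HI; rewrite /fano_bound.
have I0 : 0 <= I.
  by have := HI 0%R (lexx _); rewrite mul0r expR0 subrr mul0r addr0 ln1 subrr.
case: I HI I0 => [i| |] //= HI i0; last exact: leNye.
rewrite (_ : (1 + (1 - s) <= 0)%R = false); last first.
  by apply/negbTE; rewrite -ltNge; lra.
rewrite /ediv_Ny.
move: s0; rewrite le_eqVlt => /predU1P[s0|s0].
  rewrite -s0 lexx eqxx /= adde0 lee_fin.
  suff : (p <= 0)%R by lra.
  rewrite leNgt; apply/negP => p0.
  (* This [l] makes [l * p = i + 1] exceed [i]. *)
  have l0 : (0 <= (i + 1) / p)%R by rewrite divr_ge0 ?ltW// ltr_wpDl.
  have := HI _ l0; rewrite -s0 mulr0 addr0 ln1 subr0 divfK ?gt_eqF// lee_fin.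
  by lra.
have ls : (ln s < 0)%R by rewrite ln_lt0// s0.
rewrite (_ : (s <= 0)%R = false); last by apply/negbTE; rewrite -ltNge.
rewrite /=inver lt_eqF//= -EFinM -EFinD lee_fin.
have := HI (- ln s)%R; rewrite oppr_ge0 (ltW ls) => /(_ isT).
rewrite expRN lnK// mulrBl mul1r mulVf ?gt_eqF// lee_fin => H.
suff : ((i + ln (1 + (1 - s))) / ln s <= - p)%R by lra.
by rewrite ler_ndivrMr//; lra.
Qed.

(** * Generalized Fano inequality *)

Theorem corollary3p5 (R : realType) (dT dX dA : measure_display)
    (Theta : measurableType dT) (X : measurableType dX) (A : measurableType dA)
    (P : Theta -> probability X R)
    (mP : forall B : set X, measurable B ->
      measurable_fun [set: Theta] (fun t => P t B))
    (w : probability Theta R)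
    (L : Theta -> A -> R)
    (L01 : forall t a, L t a = 0%R \/ L t a = 1%R)
    (mL : measurable_fun [set: Theta * A] (fun p => L p.1 p.2))
    (R0_gt0 : 0 < no_data_risk w L) :
  bayes_risk w P L >=
  fano_bound (mutual_info w P) (no_data_risk w L) (sup_zero_loss w L).
Proof.
apply: le_ereal_inf_tmp => _ [dec mdec <-].
pose C : set (Theta * X) := [set z | L z.1 (dec z.2) = 0%R].
have mLdec : measurable_fun [set: Theta * X] (fun z => L z.1 (dec z.2)).
  have mpair : measurable_fun [set: Theta * X] (fun z => (z.1, dec z.2)).
    by apply: measurable_fun_pair => //; exact: measurableT_comp.
  exact: (measurableT_comp mL mpair).
have mC : measurable C.
  by rewrite -[C]setTI; exact: (mLdec measurableT _ (measurable_set1 0%R)).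
have mCt t : measurable (xsection C t) by exact: measurable_xsection.
have CE x : ysection C x = zero_loss_set L (dec x).
  by apply/seteqP; split => t; rewrite /ysection /zero_loss_set/= in_setE.
pose p := (\int[w]_t fine (P t (xsection C t)))%R.
have riskE : \int[w]_t \int[P t]_x (L t (dec x))%:E = (1 - p)%:E.
  transitivity (\int[w]_t (-1 * fine (P t (xsection C t)) + 1)%:E).
    apply: eq_integral => t _.
    have [_] := integral_affine (P t) _ (-1) 1 (integrable_indic (P t) (mCt t)).
    rewrite Rintegral_indic// => <-; apply: eq_integral => x _.
    rewrite indicE; congr EFin; rewrite mem_xsection; case: (boolP (_ \in C)).
      by rewrite in_setE => ->; rewrite mulr1 addNr.
    rewrite notin_setE mulr0 add0r => /= nC.
    by case: (L01 t (dec x)) nC.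
  have [|_ ->] :=
    integral_affine w (fine \o (fun t => P t (xsection C t))) (-1) 1.
    apply: integrable_fine_prob; first exact: measurable_fun_xsection_prob.
    by move=> t; rewrite measure_ge0 probability_le1.
  by congr EFin; rewrite mulN1r addrC.
(* [Theta] and [X] carry probabilities, so they are nonempty and [dec] provides
   an action: the supremum [s] is not taken over the empty set, hence real. *)
have [t _] : [set: Theta] !=set0.
  apply/set0P/negP => /eqP T0; have := probability_setT w.
  by rewrite T0 measure0 => /eqP; rewrite eq_sym onee_eq0.
have [x _] : [set: X] !=set0.
  apply/set0P/negP => /eqP T0; have := probability_setT (P t).
  by rewrite T0 measure0 => /eqP; rewrite eq_sym onee_eq0.
have ubs a : w (zero_loss_set L a) <= sup_zero_loss w L.
  by apply: ereal_sup_ubound; exists a.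
have s_ge0 : 0 <= sup_zero_loss w L by exact: le_trans (ubs (dec x)).
have s_le1 : sup_zero_loss w L <= 1.
  apply: ge_ereal_sup => _ [a _ <-]; apply: probability_le1.
  rewrite -[zero_loss_set _ _]setTI.
  have mLa : measurable_fun [set: Theta] (L ^~ a).
    exact: (measurableT_comp mL (pair2_measurable a)).
  exact: (mLa measurableT _ (measurable_set1 0%R)).
move: R0_gt0; rewrite riskE no_data_riskE//.
case: (sup_zero_loss w L) ubs s_ge0 s_le1 => [s| |] // ubs.
rewrite !lee_fin => s0 s1 R0.
apply: fano_bound_le; first by move: R0; rewrite -EFinB lte_fin s0/=; lra.
move=> l l0; apply: le_ereal_inf_tmp => _ [Q _ <-].
by apply: integral_kl_div_ge => // y; rewrite CE.
Qed.
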